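(* There is an attention action $X\in\mathrm{ALL}$ for which there is no equivalent epistemic action $Y\in\mathrm{noPost}$.
   Context: Language. $I\neq\emptyset$ is a finite set of agents, $N\in\mathbb{N}$ an attention bound (here $0\in\mathbb{N}$), $\Phi$ a countable set of proposition atoms, $\Psi=\{(\alpha_i<n),(\alpha_i=n): n\le N, i\in I\}$ the set of attention atoms, $At=\Phi\uplus\Psi$. The language $\mathcal{L}$ is $\varphi::=\top\mid p\mid\neg\varphi\mid\varphi\wedge\varphi\mid K_i\varphi$ with $p\in At$, $i\in I$. Attention states. An attention model is $M=(W,R,V,A)$ with $W\ne\emptyset$ a finite set of worlds; $R$ assigning to each $i\in I$ an equivalence relation $R_i$ on $W$; $V:At\to\mathcal{P}(W)$ a valuation; and $A:I\times W\to\{0,\dots,N\}$ an attention resource function such that $wR_iv$ implies $A_i(w)=A_i(v)$, for all $i\in I$. For $w\in W$, $(M,w)$ is an attention state. Satisfaction: $M,w\vDash p$ iff $w\in V(p)$ for $p\in\Phi$; $M,w\vDash(\alpha_i=n)$ iff $A_i(w)=n$; $M,w\vDash(\alpha_i<n)$ iff $A_i(w)<n$; $M,w\vDash K_i\varphi$ iff $M,v\vDash\varphi$ for all $v$ with $wR_iv$; standard clauses for $\top,\neg,\wedge$. Write $\varphi\vDash\psi$ if every attention state satisfies $\varphi\to\psi$. Attention actions. An attention action model is $\mathcal{A}=(E,Q,Q^*,pre,c)$ with $E\neq\emptyset$ a finite set of events; $Q,Q^*$ assigning to each $i\in I$ equivalence relations $Q_i,Q_i^*$ on $E$; $pre:E\to\mathcal{L}$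 assigning a precondition to each event; and a cost function $c:I\times\mathcal{L}\times E\to\mathbb{N}$ satisfying $c_i(\top,e)=0$ and such that $(e,e')\in Q_i\cup Q_i^*$ implies $c_i(\varphi,e)=c_i(\varphi,e')$, for all $i\in I$, $\varphi\in\mathcal{L}$. A question map is a map $\mathsf{q}:I\to\mathcal{L}$. An attention action is a triple $X=(\mathcal{A},\mathsf{q},e)$ with $e\in E$. $\mathrm{ALL}$ is the class of attention actions. Attention update. For $i\in I$, $\varphi\in\mathcal{L}$ let $Q_i^*[\varphi|\neg\varphi]=Q_i^*\setminus\{(e,e')\in Q_i^*: pre(e)\vDash\varphi\text{ and }pre(e')\not\vDash\varphi\}$. The update of $(M,w)=((W,R,V,A),w)$ with $X=((E,Q,Q^*,pre,c),\mathsf{q},e)$ is $(M,w)^X=((W^X,R^X,V^X,A^X),(w,e))$, where $W^X=\{(v,f)\in W\times E: M,v\vDash pre(f)\}$; $((v,f),(u,g))\in R_i^X$ iff $(v,u)\in R_i$ and $(f,g)\in Q_i\cup Q_i^*$ if $c_i(\mathsf{q}_i,f)>A_i(v)$, respectively $(f,g)\in Q_i\cup Q_i^*[\mathsf{q}_i|\neg\mathsf{q}_i]$ if $c_i(\mathsf{q}_i,f)\le A_i(v)\neq 0$; $V^X(p)=\{(v,f)\in W^X: v\in V(p)\}$ for $p\in\Phi$; $A_i^X(v,f)=\max\{0,A_i(v)-c_i(\mathsf{q}_i,f)\}$. $X$ is applicable to $(M,w)$ if $M,w\vDash pre(e)$. Epistemic states and actions. An epistemic Kripke model is $K=(W,R,V)$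 with $W\neq\emptyset$ finite, each $R_i$ ($i\in I$) an equivalence relation on $W$, and $V:At\to\mathcal{P}(W)$; $(K,w)$ with $w\in W$ is an epistemic state; satisfaction is as for attention states except that $K,w\vDash p$ iff $w\in V(p)$ for all $p\in\Phi\cup\Psi$. The Kripke rendition of $(M,w)=((W,R,V,A),w)$ is $K(M,w)=((W,R,V_A),w)$ with $V_A(p)=\{v\in W:M,v\vDash p\}$ for all $p\in\Phi\cup\Psi$. An action model is $\mathcal{E}=(E,Q,pre,post)$ with $E\ne\emptyset$ finite, each $Q_i$ ($i\in I$) an equivalence relation on $E$, $pre:E\to\mathcal{L}$, $post:E\to(At\to\mathcal{L})$; it is without postconditions if $post(e)(p)=p$ for all $e\in E$, $p\in At$. An epistemic action is $(\mathcal{E},e)$ with $e\in E$. $\mathrm{Post}$ is the class of all epistemic actions, $\mathrm{noPost}$ the class of all epistemic actions without postconditions. The product update of $(K,w)=((W,R,V),w)$ with $Y=((E,Q,pre,post),e)$ is $(K,w)^Y=((W^Y,R^Y,V^Y),(w,e))$ with $W^Y=\{(v,f)\in W\times E:K,v\vDash pre(f)\}$, $((v,f),(u,g))\in R^Y_i$ iff $(v,u)\in R_i$ and $(f,g)\in Q_i$, and $V^Y(p)=\{(v,f)\in W^Y:K,v\vDash post(f)(p)\}$. $Y$ is applicable to $(K,w)$ if $K,w\vDash pre(e)$. Equivalence. An attention action $X\in\mathrm{ALL}$ and an epistemic action $Y\in\mathrm{Post}\cup\mathrm{noPost}$ are equivalent iff for all attention states $(M,w)$ and all $\varphi\in\mathcal{L}$: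 $(M,w)^X\vDash\varphi$ iff $(K(M,w))^Y\vDash\varphi$. *)

(* Defs.v *)
From HB Require Import structures.
From mathcomp Require Import all_boot.
From mathcomp Require Import boolp.

Set Implicit Arguments.
Unset Strict Implicit.
Unset Printing Implicit Defensive.

Section Language.
Variables (I : finType) (N : nat) (Phi : countType).

Inductive att_atom : Type :=
| AttLt of I & 'I_N.+1   (* alpha_i < n *)
| AttEq of I & 'I_N.+1.  (* alpha_i = n *)

Definition atom : Type := (Phi + att_atom)%type.

Inductive form : Type :=
| Top
| Atom of atom
| Neg of form
| And of form & form
| Know of I & form.

(* Shared by attention and epistemic states, which differ only in how atoms
   are evaluated. *)
Fixpoint satisfies (W : finType) (R : I -> rel W) (val : atom -> pred W)
    (w : W) (phi : form) : bool :=
  match phi with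
  | Top => true
  | Atom p => val p w
  | Neg a => ~~ satisfies R val w a
  | And a b => satisfies R val w a && satisfies R val w b
  | Know i a => [forall v, R i w v ==> satisfies R val v a]
  end.

(* No law is imposed on a structure: the attention update below need not
   preserve the laws of [is_attention_model] (for instance, a union of two
   equivalence relations need not be transitive).  The valuation is given on
   [Phi] only, since attention atoms are always evaluated through [att]. *)
Record att_struct := AttStruct {
  aworld :> finType;
  arel : I -> rel aworld;
  aval : Phi -> pred aworld;
  att : I -> aworld -> 'I_N.+1
}.

Definition is_attention_model (M : att_struct) : Prop :=
  (forall i, equivalence_rel (@arel M i)) /\
  (forall i (w v : M), arel i w v -> att i w = att i v).

Definition att_val (M : att_struct) (p : atom) : pred M := fun w =>
  match p with
  | inl p => aval p w
  | inr (AttLt i n) => att i w < n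
  | inr (AttEq i n) => att i w == n
  end.

Definition asat (M : att_struct) (w : M) (phi : form) : bool :=
  satisfies (@arel M) (@att_val M) w phi.

Definition entails (phi psi : form) : Prop :=
  forall M : att_struct, is_attention_model M ->
  forall w : M, asat w phi -> asat w psi.

Record att_action_model := AttActionModel {
  aevent :> finType;
  aQ : I -> rel aevent;
  aQs : I -> rel aevent;
  apre : aevent -> form;
  cost : I -> form -> aevent -> nat;
  aQ_equiv : forall i, equivalence_rel (aQ i);
  aQs_equiv : forall i, equivalence_rel (aQs i);
  cost_Top : forall i e, cost i Top e = 0;
  cost_stable : forall i phi e e',
    aQ i e e' || aQs i e e' -> cost i phi e = cost i phi e'
}.

Record att_action := AttAction {
  aact :> att_action_model;
  question : I -> form;
  aactual : aact
}.

Definition cut_rel (E : att_action_model) (i : I) (phi : form) : rel E :=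
  fun e e' => aQs i e e' &&
    ~~ (`[< entails (apre e) phi >] && ~~ `[< entails (apre e') phi >]).

Section AttentionUpdate.
Variables (M : att_struct) (X : att_action).

Definition aupd_world : finType := {x : M * X | asat x.1 (apre x.2)}.

(* The two clauses do not overlap and leave out the case where both the cost
   and the available attention are 0; no pair is then related. *)
Definition aupd_rel (i : I) : rel aupd_world := fun x y =>
  let: (v, f) := val x in
  let: (u, g) := val y in
  let k := cost i (question X i) f in
  arel i v u &&
  ([&& att i v < k & aQ i f g || aQs i f g] ||
   [&& k <= att i v, att i v != 0 :> nat
     & aQ i f g || cut_rel i (question X i) f g]).

(* Truncated subtraction is max {0, att - cost}. *)
Definition aupd_att (i : I) (x : aupd_world) : 'I_N.+1 :=
  let: (v, f) := val x in
  Ordinal (leq_ltn_trans (leq_subr (cost i (question X i) f) (att i v))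
                         (ltn_ord (att i v))).

Definition att_update : att_struct :=
  AttStruct aupd_rel (fun p x => aval p (val x).1) aupd_att.

End AttentionUpdate.

Record kripke := Kripke {
  kworld :> finType;
  krel : I -> rel kworld;
  kval : atom -> pred kworld;
  krel_equiv : forall i, equivalence_rel (krel i)
}.

Definition ksat (K : kripke) (w : K) (phi : form) : bool :=
  satisfies (@krel K) (@kval K) w phi.

Definition rendition (M : att_struct) (HM : is_attention_model M) : kripke :=
  Kripke (fun p (w : M) => asat w (Atom p)) (proj1 HM).

Record action_model := ActionModel {
  event :> finType;
  eQ : I -> rel event;
  pre : event -> form;
  post : event -> atom -> form;
  eQ_equiv : forall i, equivalence_rel (eQ i)
}.

Record epi_action := EpiAction {
  eact :> action_model;
  actual : eact
}.

Definition without_postconditions (Y : epi_action) : Prop :=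
  forall (f : Y) (p : atom), post f p = Atom p.

Section ProductUpdate.
Variables (K : kripke) (Y : epi_action).

Definition pupd_world : finType := {x : K * Y | ksat x.1 (pre x.2)}.

Definition pupd_rel (i : I) : rel pupd_world := fun x y =>
  krel i (val x).1 (val y).1 && eQ i (val x).2 (val y).2.

Lemma pupd_rel_equiv (i : I) : equivalence_rel (pupd_rel i).
Proof.
move=> x y z; have HR := @krel_equiv K i; have HQ := @eQ_equiv Y i.
split; rewrite /pupd_rel.
  by rewrite (HR (val z).1 (val z).1 _).1 (HQ (val z).2 (val z).2 _).1.
case/andP=> xy xy'.
by rewrite ((HR _ _ (val z).1).2 xy) ((HQ _ _ (val z).2).2 xy').
Qed.

Definition product_update : kripke :=
  Kripke (fun p x => ksat (val x).1 (post (val x).2 p)) pupd_rel_equiv.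

End ProductUpdate.

(* An updated state exists only when the action is applicable; an undefined
   state satisfies no formula.  Hence equivalent actions are applicable to
   the same states (take [Top]). *)
Definition sat_after_att (M : att_struct) (w : M) (X : att_action)
    (phi : form) : Prop :=
  exists h : asat w (apre (aactual X)),
    asat (M := att_update M X) (Sub (w, aactual X) h) phi.

Definition sat_after_epi (K : kripke) (w : K) (Y : epi_action)
    (phi : form) : Prop :=
  exists h : ksat w (pre (actual Y)),
    ksat (K := product_update K Y) (Sub (w, actual Y) h) phi.

Definition equivalent (X : att_action) (Y : epi_action) : Prop :=
  forall (M : att_struct) (HM : is_attention_model M) (w : M) (phi : form),
    sat_after_att w X phi <-> sat_after_epi (K := rendition HM) w Y phi.

End Language.

Arguments Top {I N Phi}.

(* Main.v *)
Require Import Defs.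
From mathcomp Require Import all_boot.

(** The witness is a single always-executable event whose question costs the
    whole attention bound [N], performed at a single world where every agent
    has attention [N].  If [N > 0], it makes [alpha_i = 0] true, although this
    was false before; without postconditions no atom can change its value.  If
    [N = 0], attention never changes, but cost and attention are then both [0],
    the case left out by the definition of the updated relation: the actual
    world sees no world, so [K_i ~ T] holds, which is impossible after a product
    update because its relations are reflexive. *)

Section Witness.
Variables (I : finType) (N : nat) (Phi : countType).

Let full_rel {T : Type} : rel T := fun _ _ => true.

Let full_rel_equiv (T : Type) : equivalence_rel (@full_rel T).
Proof. by []. Qed.

(** [cost_Top] forces [Top] to be free, so the question asked below is [Neg Top]. *)
Definition exhausting_cost (phi : form I N Phi) : nat :=
  if phi is Top then 0 else N.

Definition exhausting_model : att_action_model I N Phi :=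
  @AttActionModel I N Phi unit (fun=> full_rel) (fun=> full_rel)
    (fun=> Top) (fun _ phi _ => exhausting_cost phi)
    (fun=> full_rel_equiv unit) (fun=> full_rel_equiv unit)
    (fun _ _ => erefl) (fun _ _ _ _ _ => erefl).

Definition exhausting_action : att_action I N Phi :=
  @AttAction I N Phi exhausting_model (fun=> Neg Top) tt.

Definition attentive_point : att_struct I N Phi :=
  @AttStruct I N Phi unit (fun=> full_rel) (fun _ _ => false)
    (fun _ _ => ord_max).

Lemma attentive_pointP : is_attention_model attentive_point.
Proof. by []. Qed.

Lemma exhausting_action_att0 (i : I) :
  sat_after_att (M := attentive_point) tt exhausting_action
    (Atom (inr (AttEq i ord0))).
Proof. by exists isT; rewrite /asat /= -val_eqE /= subnn. Qed.

Lemma exhausting_action_blind (i : I) : N = 0 ->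
  sat_after_att (M := attentive_point) tt exhausting_action
    (Know i (Neg Top)).
Proof.
move=> N0; exists isT; apply/forallP => -[[u g] h].
(* Cost equals attention, so the strict guard fails; the other guard needs nonzero attention. *)
by rewrite /= /aupd_rel /= N0.
Qed.

End Witness.

Lemma product_update_not_blind {I : finType} {N : nat} {Phi : countType}
    (K : kripke I N Phi) (w : K) (Y : epi_action I N Phi) (i : I) :
  ~ sat_after_epi w Y (Know i (Neg Top)).
Proof.
case=> h; rewrite /ksat /= => /forallP /(_ (Sub (w, actual Y) h)).
(* The first component of [equivalence_rel] is reflexivity. *)
by have [-> _] := pupd_rel_equiv i (Sub (w, actual Y) h)
  (Sub (w, actual Y) h) (Sub (w, actual Y) h).
Qed.

Lemma noPost_sat_atom {I : finType} {N : nat} {Phi : countType}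
    (K : kripke I N Phi) (w : K) (Y : epi_action I N Phi) (p : atom I N Phi) :
  without_postconditions Y -> sat_after_epi w Y (Atom p) -> ksat w (Atom p).
Proof. by move=> noPost [h]; rewrite /ksat /= noPost. Qed.

Theorem proposition19 (I : finType) (N : nat) (Phi : countType)
    (hI : 0 < #|I|) :
  exists X : att_action I N Phi,
    ~ exists Y : epi_action I N Phi,
        without_postconditions Y /\ equivalent X Y.
Proof.
have /card_gt0P[i _] := hI.
exists (exhausting_action I N Phi) => -[Y [noPost XY]].
have {}XY := XY _ (attentive_pointP I N Phi) tt.
have /XY /(noPost_sat_atom _ _ _ _ noPost) := exhausting_action_att0 I N Phi i.
(* The atom already held before the update, where attention is [ord_max]; this forces [N = 0]. *)
rewrite /ksat /= /asat /= -val_eqE /= => /eqP N0.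
have /XY := exhausting_action_blind I N Phi i N0.
exact: product_update_not_blind.
Qed.
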